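(* Let $k\ge2$ and let $H_2$ be a $k$-minimal graph (with vertex set $[3]^k$). Then $|E(H_2)|=k\cdot(3^{k-1}+2^{k-1})$ if and only if $H_2\in\mathcal Q_k$.
   Context: All graphs are finite and simple. $[k]=\{1,\dots,k\}$; $[3]^k$ is the set of vectors $x=(x_{(1)},\dots,x_{(k)})$ with entries in $\{1,2,3\}$. For a graph $F$ and $S\subseteq V(F)$, $\mathcal E(F,S)$ is the set of all $S$-coverings in $F$, i.e. sets $E\subseteq E(F)$ such that every vertex of $S$ is incident to at least one edge of $E$. $\overline K_{[k]}$ is the edgeless graph on $[k]$. For a graph $H_2$ on $[3]^k$, $\overline K_{[k]}\circ H_2$ is the graph on the disjoint union $[k]\sqcup[3]^k$ with edge set $E(H_2)\cup\{\{i,x\}: i\in[k],\ x\in[3]^k,\ x_{(i)}=1\}$. For a set $E$ of 2-subsets of $[3]^k$, $span(E)$ is the graph with vertex set $[3]^k$ and edge set $E$. For $i\in[k]$ and $j\in\{1,2,3\}$ let $[3]^k_i(j)=\{x\in[3]^k:x_{(i)}=j\}$. Let $C^k_i$ be the bipartite graph with parts $[3]^k_i(1)$ and $[3]^k_i(2)$, in which $x\in[3]^k_i(1)$ and $y\in[3]^k_i(2)$ are adjacent iff $|x_{(t)}-y_{(t)}|\le1$ for all $t\in[k]\setminus\{i\}$; let $D^k_i$ be the bipartite graph with parts $[3]^k_i(2)$ and $[3]^k_i(3)$, in which $x\in[3]^k_i(2)$ and $y\in[3]^k_i(3)$ are adjacent iff $|x_{(t)}-y_{(t)}|\le1$ for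 all $t\in[k]\setminus\{i\}$. Let $S^k_i=\{x\in[3]^k: x_{(i)}=3,\ x_{(t)}\in\{2,3\}\ \forall t\in[k]\}$. Define $$\mathcal C_k=\Big\{\overline K_{[k]}\circ span\Big(\bigcup_{i\in[k]}(E_i\cup F_i)\Big): E_i\in\mathcal E(C^k_i,[3]^k_i(2)),\ F_i\in\mathcal E(D^k_i,S^k_i)\ \text{for each } i\in[k]\Big\}.$$ $H_2$ is called $k$-minimal if $\overline K_{[k]}\circ H_2\in\mathcal C_k$ and $\overline K_{[k]}\circ H_2'\notin\mathcal C_k$ for every spanning subgraph $H_2'\ne H_2$ of $H_2$. The family $\mathcal Q_k$: let $X=\{2,3\}^k\subseteq[3]^k$ and $\overline X=[3]^k\setminus X$. For $i\in[k]$ and $x\in[3]^k_i(2)\cup S^k_i$, let $\epsilon_i(x)$ be the set of all 2-subsets $\{x,x'\}$ of $[3]^k$ with $x'_{(i)}=x_{(i)}-1$ such that for each $t\in[k]\setminus\{i\}$: (i) if $x\in S^k_i$, then $x'_{(t)}=x_{(t)}$; (ii) if $x\in X\cap[3]^k_i(2)$, then $x'_{(t)}\in\{2,3\}$ when $x_{(t)}=2$, and $x'_{(t)}=3$ when $x_{(t)}=3$; (iii) if $x\in\overline X\cap[3]^k_i(2)$, then $x'_{(t)}=1$ when $x_{(t)}=1$, and $x'_{(t)}\in\{2,3\}$ when $x_{(t)}\in\{2,3\}$. Then $\mathcal Q_k$ is the set of all graphs of the form $span\big(\bigcup_{i\in[k]}\bigcup_{x\in[3]^k_i(2)\cup S^k_i}\{e_i(x)\}\big)$,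 where for each such pair $(i,x)$ an edge $e_i(x)\in\epsilon_i(x)$ is chosen. *)

(* Defs.v *)
From HB Require Import structures.
From mathcomp Require Import all_boot all_order all_algebra.

Set Implicit Arguments.
Unset Strict Implicit.
Unset Printing Implicit Defensive.

Section Graphs.
Variable T : finType.

Record graph := Graph {
  verts : {set T};
  edges : {set {set T}};
  edgesP : [forall e in edges, (#|e| == 2) && (e \subset verts)] }.

Definition coverings (F : graph) (S : {set T}) : {set {set {set T}}} :=
  [set E : {set {set T}} |
    (E \subset edges F) && [forall v in S, [exists e in E, v \in e]]].

Definition spanning_subgraph (G H : graph) : Prop :=
  verts G = verts H /\ edges G \subset edges H.

Lemma span_graph_subproof (E : {set {set T}}) :
  [forall e in [set e in E | #|e| == 2], (#|e| == 2) && (e \subset [set: T])].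
Proof.
by apply/forall_inP => e; rewrite inE => /andP[_ ->]; rewrite subsetT.
Qed.

(* The filter makes [span_graph] total; it is the identity on every set of
   2-subsets, the only sets to which [span_graph] is applied below. *)
Definition span_graph (E : {set {set T}}) : graph :=
  Graph (span_graph_subproof E).

End Graphs.

(* [3]^k: the index set [k] is 'I_k (shifted by one), and the entries are
   stored in 'I_3; [coord x i] is the actual entry x_(i) in {1, 2, 3}. *)
Definition vec3 (k : nat) : finType := {ffun 'I_k -> 'I_3}.

Section Families.
Variable k : nat.
Implicit Types (i t : 'I_k) (x y : vec3 k).

Definition coord x i : nat := (x i).+1.

Lemma compK_subproof (H : graph (vec3 k)) :
  [forall e in [set [set inr x | x in e] | e : {set vec3 k} in edges H]
     :|: [set [set inl i; inr x]
           | i : 'I_k, x : vec3 k in [set x in verts H | coord x i == 1]],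
   (#|e| == 2) &&
   (e \subset [set (inl i : 'I_k + vec3 k) | i : 'I_k]
          :|: [set inr x | x in verts H])].
Proof.
apply/forall_inP => e; rewrite inE => /orP[].
  case/imsetP => f fH ->; have /andP[f2 sfH] := forall_inP (edgesP H) _ fH.
  rewrite card_imset ?f2 /=; last by move=> ? ? [].
  by apply/subsetP => _ /imsetP[x xf ->]; rewrite inE imset_f ?orbT ?(subsetP sfH).
case/imset2P => i x _; rewrite inE => /andP[xH _] ->; rewrite cards2 /=.
apply/subsetP => z; rewrite !inE => /orP[]/eqP->; first by rewrite imset_f.
by rewrite imset_f ?orbT.
Qed.

(* The composition of the edgeless graph on [k] with [H]. *)
Definition compK (H : graph (vec3 k)) : graph ('I_k + vec3 k)%type :=
  Graph (compK_subproof H).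

Definition slice i (j : nat) : {set vec3 k} := [set x | coord x i == j].

Definition near_off i x y : bool :=
  [forall (t | t != i), `|coord x t - coord y t|%N <= 1].

Lemma layer_graph_subproof i j :
  [forall e in [set [set x; y] | x in slice i j, y in slice i j.+1
                                 & near_off i x y],
   (#|e| == 2) && (e \subset slice i j :|: slice i j.+1)].
Proof.
apply/forall_inP => e /imset2P[x y xi]; rewrite inE => /andP[yi _] ->.
have xy : x != y.
  apply: contraTneq xi => ->; move: yi; rewrite !inE => /eqP->.
  by rewrite neq_ltn ltnSn orbT.
rewrite cards2 xy /=; apply/subsetP => z; case/set2P => ->; rewrite in_setU ?xi //.
by rewrite yi orbT.
Qed.

Definition layer_graph i j : graph (vec3 k) :=
  Graph (layer_graph_subproof i j).

Definition Cgraph i := layer_graph i 1.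
Definition Dgraph i := layer_graph i 2.

Definition Sset i : {set vec3 k} :=
  [set x | (coord x i == 3) && [forall t, coord x t \in [:: 2; 3]]].

Definition calC (G : graph ('I_k + vec3 k)%type) : Prop :=
  exists E F : 'I_k -> {set {set vec3 k}},
    [/\ forall i, E i \in coverings (Cgraph i) (slice i 2),
        forall i, F i \in coverings (Dgraph i) (Sset i)
      & G = compK (span_graph (\bigcup_i (E i :|: F i)))].

Definition kminimal (H : graph (vec3 k)) : Prop :=
  calC (compK H) /\
  forall H' : graph (vec3 k),
    spanning_subgraph H' H -> H' <> H -> ~ calC (compK H').

Definition Xset : {set vec3 k} := [set x | [forall t, coord x t \in [:: 2; 3]]].

Definition eps i x : {set {set vec3 k}} :=
  [set [set x; x'] | x' : vec3 k &
    (coord x' i == (coord x i).-1) &&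
    [forall (t | t != i),
      [&& (x \in Sset i) ==> (coord x' t == coord x t),
          (x \in Xset :&: slice i 2) ==>
            ((coord x t == 2) ==> (coord x' t \in [:: 2; 3])) &&
            ((coord x t == 3) ==> (coord x' t == 3))
        & (x \in ~: Xset :&: slice i 2) ==>
            ((coord x t == 1) ==> (coord x' t == 1)) &&
            ((coord x t \in [:: 2; 3]) ==> (coord x' t \in [:: 2; 3]))]]].

Definition calQ (H : graph (vec3 k)) : Prop :=
  exists e : 'I_k -> vec3 k -> {set vec3 k},
    (forall i x, x \in slice i 2 :|: Sset i -> e i x \in eps i x) /\
    H = span_graph (\bigcup_i \bigcup_(x in slice i 2 :|: Sset i) [set e i x]).

End Families.

(* Main.v *)
Require Import Defs.
From HB Require Import structures.
From mathcomp Require Import all_boot all_order all_algebra.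
From mathcomp Require Import zify.
(* vector.v also exports a [coord]; this makes [Defs.coord] visible again. *)
Import Defs.

Set Implicit Arguments.
Unset Strict Implicit.
Unset Printing Implicit Defensive.

(* A member of calC is an edge set meeting every demand (i, x) with
   x in slice i 2 or Sset i, where an edge {x, x'} meets (i, x) when x' lies one
   step below x in coordinate i.  Minimality gives every edge a private demand,
   and there are k (3^(k-1) + 2^(k-1)) demands; so equality holds exactly when
   edges and demands correspond bijectively under "meets".  The conditions
   defining eps i x say precisely that an edge meeting (i, x) meets no other
   demand. *)

(** * Graph equality, and counting with private elements *)

Lemma graph_eq (T : finType) (G H : graph T) :
  verts G = verts H -> edges G = edges H -> G = H.
Proof.
case: G H => [V E p] [V' E' p'] /= eV eE; move: p p'; rewrite eV eE => p p'.
by congr Graph; apply: bool_irrelevance.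
Qed.

Lemma card_edge (T : finType) (G : graph T) e : e \in edges G -> #|e| == 2.
Proof. by move=> eG; case/andP: (forall_inP (edgesP G) _ eG). Qed.

Lemma edges_span_edges (T : finType) (G : graph T) (E : {set {set T}}) :
  E \subset edges G -> edges (span_graph E) = E.
Proof.
move=> sE; apply/setP => e; rewrite inE andb_idr // => /(subsetP sE).
exact: card_edge.
Qed.

(** Sending each [e] to a private [r] is injective, so equal cardinalities make it onto and every
    [r] in [R] is private to some member of [E]. An [e] that meets [r] and [r'] therefore owns both,
    and each is the value chosen at [e]. *)
Lemma private_bijection (S T : finType) (E : {set S}) (R : {set T})
    (m : S -> T -> bool) :
  (forall e, e \in E -> exists2 r, r \in R &
     m e r /\ forall e', e' \in E -> m e' r -> e' = e) ->
  #|E| = #|R| ->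
  [/\ forall e, e \in E -> exists2 r, r \in R & m e r,
      forall r, r \in R -> exists2 e, e \in E & m e r
    & forall e r r', e \in E -> r \in R -> r' \in R -> m e r -> m e r' ->
        r = r'].
Proof.
move=> priv cER.
pose P e r := [&& r \in R, m e r & [forall e' in E, m e' r ==> (e' == e)]].
have exP e : e \in E -> exists r, P e r.
  move=> /priv[r rR [er ur]]; exists r; rewrite /P rR er /=.
  by apply/forall_inP => e' e'E; apply/implyP => /(ur _ e'E) ->.
(* [T] may be empty, so the choice lands in [option T] and its image is compared with
   [Some @: R]. *)
pose f (e : S) : option T := [pick r | P e r].
have fP e : e \in E -> exists2 r, f e = Some r & P e r.
  move=> /exP[r Pr]; rewrite /f; case: pickP => [r' Pr'|/(_ r)]; first by exists r'.
  by rewrite Pr.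
have uniqP e e' r : e' \in E -> P e r -> m e' r -> e' = e.
  by move=> e'E /and3P[_ _ /forall_inP/(_ _ e'E)/implyP h] /h/eqP.
have mP e r : P e r -> m e r by case/and3P.
have finj : {in E &, injective f}.
  move=> e e' eE e'E; have [r -> Pr] := fP _ eE; have [r' -> Pr'] := fP _ e'E.
  by case=> rr; apply: uniqP Pr' _ => //; rewrite -rr; apply: mP.
have fE : f @: E = Some @: R.
  apply/eqP; rewrite eqEcard (card_in_imset finj) card_imset ?cER ?leqnn ?andbT;
    last by move=> ? ? [].
  apply/subsetP => _ /imsetP[e eE ->]; have [r -> /and3P[rR _ _]] := fP _ eE.
  exact: imset_f.
have ownP r : r \in R -> exists2 e, e \in E & f e = Some r /\ P e r.
  move=> rR; have: Some r \in f @: E by rewrite fE imset_f.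
  case/imsetP => e eE fer; exists e => //.
  by have [r' fr' Pr'] := fP _ eE; rewrite -fer; move: fr' Pr'; rewrite -fer => -[->].
split=> [e /priv[r rR [er _]] | r /ownP[e eE [_ /mP er]] | e r r' eE rR r'R er er'].
- by exists r.
- by exists e.
have [e1 _ [f1 P1]] := ownP _ rR; have [e2 _ [f2 P2]] := ownP _ r'R.
have e1E := uniqP _ _ _ eE P1 er; have e2E := uniqP _ _ _ eE P2 er'.
by apply: Some_inj; rewrite -f1 -f2 -e1E -e2E.
Qed.

(** * Demands and the edges that meet them *)

Section Demands.
Variable k : nat.
Implicit Types (i j t : 'I_k) (x y : vec3 k) (e : {set vec3 k}).
Implicit Types (H : graph (vec3 k)) (E : {set {set vec3 k}}).

Lemma coord_bounds x t : 0 < coord x t <= 3.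
Proof. by rewrite /coord ltn_ord. Qed.

Lemma near_off_sym i x y : near_off i x y = near_off i y x.
Proof. by apply: eq_forallb => t; rewrite distnC. Qed.

Definition demands : {set 'I_k * vec3 k} :=
  [set r | r.2 \in slice r.1 2 :|: Sset r.1].

(** No layer is mentioned: the same relation serves the layers between entries 1, 2 and between
    entries 2, 3. It is oriented, [r.2] being the upper end of the edge in direction [r.1]. *)
Definition meets e (r : 'I_k * vec3 k) : bool :=
  [exists y, [&& e == [set r.2; y], near_off r.1 r.2 y &
                 coord r.2 r.1 == (coord y r.1).+1]].

Lemma Sset_slice i x : x \in Sset i -> x \in slice i 3.
Proof. by rewrite !inE => /andP[]. Qed.

Lemma Sset_Xset i x : (x \in Sset i) = (coord x i == 3) && (x \in Xset k).
Proof. by rewrite !inE. Qed.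

Lemma XsetP x : reflect (forall t, 1 < coord x t) (x \in Xset k).
Proof.
rewrite inE; apply: (iffP forallP) => h t; have := h t; have := coord_bounds x t;
  rewrite !inE; lia.
Qed.

Lemma demandsP i x :
  reflect (coord x i = 2 \/ (coord x i = 3 /\ forall t, 1 < coord x t))
          ((i, x) \in demands).
Proof.
rewrite inE /= in_setU Sset_Xset [x \in slice _ _]inE; apply: (iffP orP).
  by case=> [/eqP ->|/andP[/eqP -> /XsetP]]; [left|right].
by case=> [->|[-> h]]; [left|right; apply/andP; split=> //; apply/XsetP].
Qed.

(** Closeness may be asked at [i] too, since the step there is exactly 1; the condition becomes
    symmetric in [x] and [y] and suits [lia]. *)
Lemma meetsP e i x :
  reflect (exists y, [/\ e = [set x; y], coord x i = (coord y i).+1 &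
             forall t, coord x t <= (coord y t).+1 /\ coord y t <= (coord x t).+1])
          (meets e (i, x)).
Proof.
apply: (iffP existsP) => -[y] /=.
  case/and3P => /eqP -> /forallP near /eqP d; exists y; split=> // t.
  case: (eqVneq t i) => [->|ti]; first by lia.
  by have := implyP (near t) ti; lia.
case=> -> d near; exists y; rewrite eqxx d eqxx andbT /=.
by apply/forallP => t; apply/implyP => _; have := near t; lia.
Qed.

Lemma meets_layer i (j : nat) x e : x \in slice i j.+1 ->
  meets e (i, x) = (e \in edges (layer_graph i j)) && (x \in e).
Proof.
rewrite inE => /eqP xj; apply/existsP/andP => [[y /and3P[/eqP -> nr /eqP d]]|].
  rewrite /= in nr d *; rewrite !inE eqxx; split=> //.
  rewrite setUC; apply: imset2_f; rewrite !inE; first by apply/eqP; lia.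
  by rewrite xj eqxx near_off_sym.
case=> /imset2P[y z]; rewrite !inE => /eqP yj /andP[/eqP zj nr] ->.
(* The vertex [x] lies in the upper slice, so it cannot be the lower end [y]. *)
case/set2P => xe; first by move: yj; rewrite -xe; lia.
exists y; rewrite /= setUC xe eqxx near_off_sym nr /=; apply/eqP; lia.
Qed.

(** * Membership in [calC] and minimality in terms of demands *)

Definition in_layers e : bool :=
  [exists i, (e \in edges (Cgraph i)) || (e \in edges (Dgraph i))].

(** The edges of [H] are recovered as the edges of the composition inside the [inr] copy: every
    joining edge contains some [inl i]. *)
Lemma compK_edges_inj H H' : compK H = compK H' -> edges H = edges H'.
Proof.
have mem G e : (e \in edges G) = ((inr : _ -> 'I_k + vec3 k) @: e \in edges (compK G)).
  rewrite /= in_setU; apply/idP/orP => [eG|].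
    by left; apply: (imset_f (fun f : {set vec3 k} => (inr : _ -> 'I_k + vec3 k) @: f)).
  case=> [/imsetP[f fG]|/imset2P[i x _ _ eq_e]].
    by move/imset_inj => -> // ? ? [].
  have: inl i \in [set inl i; inr x : 'I_k + vec3 k] by rewrite !inE eqxx.
  by rewrite -eq_e => /imsetP[].
by move=> eqH; apply/setP => e; rewrite !mem eqH.
Qed.

Lemma calCP H : verts H = [set: vec3 k] ->
  calC (compK H) <->
  (forall e, e \in edges H -> in_layers e) /\
  (forall r, r \in demands -> exists2 e, e \in edges H & meets e r).
Proof.
move=> vH; split.
  case=> E [F [/= covE covF /compK_edges_inj eH]].
  have {}covE i : E i \subset edges (Cgraph i) /\
      forall v, v \in slice i 2 -> exists2 e, e \in E i & v \in e.
    have:= covE i; rewrite inE => /andP[-> /forall_inP h]; split=> // v /h.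
    by case/exists_inP => e; exists e.
  have {}covF i : F i \subset edges (Dgraph i) /\
      forall v, v \in Sset i -> exists2 e, e \in F i & v \in e.
    have:= covF i; rewrite inE => /andP[-> /forall_inP h]; split=> // v /h.
    by case/exists_inP => e; exists e.
  have {}eH : edges H = \bigcup_i (E i :|: F i).
    rewrite eH; apply/setP => e; rewrite inE andb_idr // => /bigcupP[i _].
    by case/setUP => [/(subsetP (covE i).1)|/(subsetP (covF i).1)]; apply: card_edge.
  rewrite eH; split=> [e /bigcupP[i _]|[i x]].
    case/setUP => [/(subsetP (covE i).1) h|/(subsetP (covF i).1) h];
      by apply/existsP; exists i; rewrite h ?orbT.
  rewrite inE /= => /setUP[x2|xS].
    have [e eE xe] := (covE i).2 _ x2; exists e.
      by apply/bigcupP; exists i => //; rewrite inE eE.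
    by rewrite (meets_layer _ x2) xe (subsetP (covE i).1 _ eE).
  have [e eF xe] := (covF i).2 _ xS; exists e.
    by apply/bigcupP; exists i => //; rewrite inE eF orbT.
  by rewrite (meets_layer _ (Sset_slice xS)) xe (subsetP (covF i).1 _ eF).
case=> lay met.
(* The largest candidates are taken as coverings; since every edge of [H] lies in some layer, their
   union is all of [edges H]. *)
exists (fun i => edges H :&: edges (Cgraph i)).
exists (fun i => edges H :&: edges (Dgraph i)); split.
- move=> i; rewrite inE subsetIr; apply/forall_inP => x x2.
  have [|e eH] := met (i, x); first by rewrite inE /= inE x2.
  rewrite (meets_layer _ x2) => /andP[eC xe].
  by apply/exists_inP; exists e; rewrite // inE eH.
- move=> i; rewrite inE subsetIr; apply/forall_inP => x xS.
  have [|e eH] := met (i, x); first by rewrite inE /= in_setU xS orbT.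
  rewrite (meets_layer _ (Sset_slice xS)) => /andP[eC xe].
  by apply/exists_inP; exists e; rewrite // inE eH.
congr compK; apply: graph_eq => //.
rewrite (@edges_span_edges _ H).
  apply/setP => e; apply/idP/bigcupP => [eH|[i _]]; last first.
    by rewrite -setIUr => /setIP[].
  by have /existsP[i ei] := lay _ eH; exists i => //; rewrite -setIUr !inE eH.
by apply/bigcupsP => i _; rewrite -setIUr subsetIl.
Qed.

(** Deleting [e] leaves all edges in layers, so by minimality some demand becomes unmet. As [H]
    meets it, [e] alone did. *)
Lemma kminimal_private H e : verts H = [set: vec3 k] -> kminimal H ->
  e \in edges H -> exists2 r, r \in demands &
    meets e r /\ forall e', e' \in edges H -> meets e' r -> e' = e.
Proof.
move=> vH [/(calCP vH)[lay met] minH] eH.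
pose H' := span_graph (edges H :\ e).
have eH' : edges H' = edges H :\ e by apply: (@edges_span_edges _ H); apply: subsetDl.
have notC : ~ calC (compK H').
  apply: minH; first by split; rewrite ?vH // eH' subsetDl.
  by move=> /(congr1 (fun G => e \in edges G)); rewrite eH' !inE eqxx eH.
case: (boolP [exists r in demands, [forall e' in edges H :\ e, ~~ meets e' r]]).
  case/exists_inP => r rd /forall_inP nm; exists r => //.
  have un e' : e' \in edges H -> meets e' r -> e' = e.
    move=> e'H m'; apply/eqP/negPn/negP => ne.
    by have := nm e'; rewrite !inE ne e'H m' => /(_ isT).
  by split=> //; have [e' e'H m'] := met r rd; rewrite -(un e').
rewrite negb_exists_in => /forall_inP all_met; case: notC; apply/calCP => //.
rewrite eH'; split=> [f /setD1P[_ /lay //]|r /all_met].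
by rewrite negb_forall_in => /exists_inP[f fE /negPn]; exists f.
Qed.

(** * Members of [eps i x] are the edges meeting the demand [(i, x)] only *)

Lemma eps_meets i x e : (i, x) \in demands -> e \in eps i x -> meets e (i, x).
Proof.
move=> ixd /imsetP[y]; rewrite inE => /andP[/eqP yi /forallP nb ->].
have xi : coord x i = (coord y i).+1 by case/demandsP: ixd => [|[]]; lia.
apply/meetsP; exists y; split=> // t.
case: (eqVneq t i) => [->|ti]; first by lia.
have /and3P[/implyP a /implyP b /implyP c] := implyP (nb t) ti.
move: ixd; rewrite inE /= in_setU => /orP[x2|/a/eqP->]; last by lia.
move: b c; rewrite !in_setI in_setC x2 !andbT => b c.
have := coord_bounds x t; have := coord_bounds y t.
case: (boolP (x \in Xset k)) => [xX|/c]; last by rewrite !inE; lia.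
by have := b xX; move/XsetP: xX => /(_ t); rewrite !inE; lia.
Qed.

(** Write the edge as [{x, z}]. For [j = i] the orientation forces [y = x]. For [j] other than [i],
    if [x] is in [Sset i] then [x] and [z] agree at [j]. Otherwise [z] has entry 1 at [i], so it is
    outside [Xset]. A demand with entry 2 at [j] would need entries 1 and 2 there, which (ii) and
    (iii) exclude; one with entry 3 has its vertex in [Xset], so [y = x], and (ii) keeps the 3. *)
Lemma eps_meets_unique i j x y e : (i, x) \in demands -> e \in eps i x ->
  (j, y) \in demands -> meets e (j, y) -> (j, y) = (i, x).
Proof.
move=> ixd /imsetP[z]; rewrite inE => /andP[/eqP zi /forallP nb ->] jyd.
have xi : coord x i = (coord z i).+1 by case/demandsP: ixd => [|[]]; lia.
case/meetsP => w [exz yj _].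
have : (y = x /\ w = z) \/ (y = z /\ w = x).
  have := set21 y w; have := set22 y w; rewrite -exz => /set2P w2 /set2P y2.
  have nyw : y <> w by move=> yw; move: yj; rewrite yw; lia.
  by case: w2 => wE; case: y2 => yE; [case: nyw | right | left | case: nyw];
    rewrite ?yE ?wE.
move=> yw; case: (eqVneq j i) => [ji|ji].
  by case: yw => -[yE wE]; move: yj; rewrite ji yE wE; [|lia].
have /and3P[/implyP a /implyP b /implyP c] := implyP (nb j) ji.
move: ixd; rewrite inE /= in_setU => /orP[x2|/a/eqP zj]; last first.
  by case: yw => -[yE wE]; move: yj; rewrite yE wE zj; lia.
move: b c; rewrite !in_setI in_setC x2 !andbT => b c.
have xi2 : coord x i = 2 by move: x2; rewrite inE => /eqP.
have yX : y \in Xset k -> y = x.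
  case: yw => -[-> _] // /XsetP/(_ i); lia.
have bx := coord_bounds x j; have bz := coord_bounds z j.
exfalso; case/demandsP: jyd => [y2|[y3 /XsetP yX']].
  case: (boolP (x \in Xset k)) => [xX|/c].
    have := b xX; move/XsetP: xX => /(_ j); rewrite !inE.
    by case: yw => -[yE wE]; move: yj y2; rewrite yE wE; lia.
  by rewrite !inE; case: yw => -[yE wE]; move: yj y2; rewrite yE wE; lia.
have yE := yX yX'.
have : x \in Xset k by rewrite -yE.
move/b; rewrite !inE.
by case: yw => -[yE' wE]; move: yj y3; rewrite ?wE yE; lia.
Qed.

(** Each violation of the conditions is a unit step in a coordinate [t] other than [i] whose upper
    end, [x] or [y], carries a demand in direction [t]: a second demand met by [e]. *)
Lemma meets_eps i x e : (i, x) \in demands -> meets e (i, x) ->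
  (forall r, r \in demands -> meets e r -> r = (i, x)) -> e \in eps i x.
Proof.
move=> ixd /meetsP[y [ey xi near]] un.
have noX t : t != i -> (t, x) \in demands -> coord x t <> (coord y t).+1.
  move=> ti txd d; have /un : meets e (t, x) by apply/meetsP; exists y.
  by case/(_ txd) => tE; rewrite tE eqxx in ti.
have noY t : (t, y) \in demands -> coord y t <> (coord x t).+1.
  move=> tyd d; have /un : meets e (t, y).
    by apply/meetsP; exists x; split=> [||s]; rewrite 1?setUC //; have := near s; lia.
  by case/(_ tyd) => _ yx; move: xi; rewrite yx; lia.
rewrite ey; apply: imset_f; rewrite inE xi eqxx /=.
apply/forallP => t; apply/implyP => ti.
have := near t; have := coord_bounds x t; have := coord_bounds y t => byt bxt nt.
have x2 s : s != i -> coord x s = 2 -> coord y s <> 1.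
  by move=> si xs ys; apply: (noX s si); [apply/demandsP; left|lia].
have y2 : coord y t = 2 -> coord x t <> 1.
  by move=> yt xt; apply: (noY t); [apply/demandsP; left|lia].
have x3 : x \in Xset k -> coord x t = 3 -> coord y t <> 2.
  by move=> /XsetP xX xt yt; apply: (noX t ti); [apply/demandsP; right|lia].
have y3 : x \in Sset i -> coord y t = 3 -> coord x t <> 2.
  rewrite Sset_Xset => /andP[/eqP xi3 /XsetP xX] yt xt.
  (* For [(t, y)] to be a demand, [y] must lie in [Xset]: its entry at [i] is 2, and elsewhere an
     entry 1 would lie below an entry 2 of [x], against [x2]. *)
  apply: (noY t); [apply/demandsP; right; split=> // s|lia].
  case: (eqVneq s i) => [->|si]; first by lia.
  by have := xX s; have := near s; have := x2 s si; have := coord_bounds y s; lia.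
apply/and3P; split; apply/implyP.
- move=> xS; have := y3 xS; have := x2 t ti; move: xS.
  rewrite Sset_Xset => /andP[_ xX]; have := x3 xX; move/XsetP: xX => /(_ t); lia.
- by case/setIP => /x3; have := x2 t ti; rewrite !inE; lia.
- by have := x2 t ti; rewrite !inE; lia.
Qed.

(** * The number of demands *)

Lemma card_box i (a : 'I_3) (B : {set 'I_3}) :
  #|[set x : vec3 k | (x i == a) && [forall (t | t != i), x t \in B]]|
    = #|B| ^ k.-1.
Proof.
pose F t : {set 'I_3} := if t == i then [set a] else B.
have -> : #|[set x : vec3 k | (x i == a) && [forall (t | t != i), x t \in B]]|
    = #|family F|.
  apply: eq_card => x; rewrite inE; apply/andP/familyP.
    case=> xi /forallP xB t; rewrite /F.
    case: (eqVneq t i) => [->|ti]; first by rewrite inE.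
    exact: implyP (xB t) ti.
  move=> xF; have := xF i; rewrite /F eqxx inE; split=> //.
  by apply/forallP => t; apply/implyP => ti; have := xF t; rewrite /F (negPf ti).
rewrite card_family foldrE big_map big_enum /= (bigD1 i) //= {1}/F eqxx cards1 mul1n.
rewrite (eq_bigr (fun=> #|B|)) => [|t ti]; last by rewrite /F (negPf ti).
by rewrite prod_nat_const cardC1 card_ord.
Qed.

Lemma card_demands : #|demands| = k * (3 ^ k.-1 + 2 ^ k.-1).
Proof.
have cs i : #|slice i 2 :|: Sset i| = 3 ^ k.-1 + 2 ^ k.-1.
  rewrite cardsU (_ : slice i 2 :&: Sset i = set0); last first.
    apply/setP => x; rewrite !inE; apply/negP => /and3P[/eqP ->]; lia.
  rewrite cards0 subn0; congr (_ + _).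
    (* Stored entries are shifted by one, so [inord 1] stands for entry 2; the other coordinates are
       free. *)
    rewrite -[3 in RHS]card_ord -cardsT -(card_box i (inord 1)).
    apply: eq_card => x; rewrite !inE /coord -val_eqE /= inordK // eqSS.
    by rewrite andb_idr // => _; apply/forallP => t; rewrite inE implybT.
  (* The factor 2 counts the stored values other than 0, that is, the entries 2 and 3. *)
  rewrite (_ : 2 = #|[set~ (ord0 : 'I_3)]|); last by rewrite cardsC1 card_ord.
  rewrite -(card_box i (inord 2)); apply: eq_card => x.
  rewrite Sset_Xset inE -val_eqE /= inordK // /coord eqSS.
  apply/andP/andP => -[/eqP x2 h]; rewrite x2; split=> //.
    apply/forallP => t; apply/implyP => _; rewrite !inE -val_eqE /= -lt0n.
    exact: (XsetP _ h t).
  apply/XsetP => t; case: (eqVneq t i) => [->|ti]; first by rewrite /coord x2.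
  by have := implyP (forallP h t) ti; rewrite !inE -val_eqE /= -lt0n.
rewrite -sum1_card (eq_bigl (fun r => xpredT r.1 && (r.2 \in slice r.1 2 :|: Sset r.1)));
  last by move=> r; rewrite inE.
rewrite -(pair_big_dep xpredT (fun i x => x \in slice i 2 :|: Sset i) (fun _ _ => 1)).
rewrite (eq_bigr (fun=> 3 ^ k.-1 + 2 ^ k.-1)) => [|i _]; last by rewrite sum1_card cs.
by rewrite sum_nat_const card_ord.
Qed.

End Demands.

(** * The equivalence *)

Theorem corollary4p23 (k : nat) (hk : 2 <= k) (H2 : graph (vec3 k))
    (hV : verts H2 = [set: vec3 k]) (hmin : kminimal H2) :
  #|edges H2| = k * (3 ^ k.-1 + 2 ^ k.-1) <-> calQ H2.
Proof.
rewrite -card_demands; split=> [cE | [e [e_eps eH]]].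
  have [ex_r ex_e uniq_r] :=
    private_bijection (fun e => @kminimal_private k H2 e hV hmin) cE.
  (* The default [set0] never occurs on a demand, by [gP]. *)
  pose g i x := odflt set0 [pick e in edges H2 | meets e (i, x)].
  have gP i x : (i, x) \in demands k -> g i x \in edges H2 /\ meets (g i x) (i, x).
    move=> /ex_e[e eH m]; rewrite /g; case: pickP => [e' /andP[]//|/(_ e)].
    by rewrite eH m.
  exists g; split=> [i x ixd|].
    have ixd' : (i, x) \in demands k by rewrite inE.
    have [gH gm] := gP _ _ ixd'; apply: meets_eps => // r rd rm.
    exact: uniq_r gH rd ixd' rm gm.
  have gH : edges H2 = \bigcup_i \bigcup_(x in slice i 2 :|: Sset i) [set g i x].
    apply/setP => e; apply/idP/bigcupP => [eH|[i _ /bigcupP[x xd /set1P ->]]].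
      have [[i x] rd m] := ex_r _ eH; have [gE gm] := gP _ _ rd.
      exists i => //; apply/bigcupP; exists x; first by move: rd; rewrite inE.
      (* The private demand of [e] equals [(i, x)], as [e] meets only one; hence the edge [g i x]
         chosen for it is [e]. *)
      have [r' r'd [m' u]] := kminimal_private hV hmin eH.
      have rr' := uniq_r _ _ _ eH rd r'd m m'.
      by rewrite (u _ gE) ?set11 // -rr'.
    by have [] : g i x \in edges H2 /\ meets (g i x) (i, x) by apply: gP; rewrite inE.
  by apply: graph_eq => //; rewrite (@edges_span_edges _ H2) -gH.
pose h (r : 'I_k * vec3 k) := e r.1 r.2.
have heps r : r \in demands k -> h r \in eps r.1 r.2.
  by rewrite inE => /e_eps.
(* Conversely, an edge chosen for two demands would meet both; injectivity then gives as many edges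
   as demands. *)
have hinj : {in demands k &, injective h}.
  move=> [i x] [j y] rd rd' hE; apply: (eps_meets_unique rd' (heps _ rd') rd).
  by rewrite -/(h (j, y)) -hE; apply: eps_meets => //; apply: heps rd.
rewrite -(card_in_imset hinj) eH; apply: eq_card => f; rewrite !inE.
apply/andP/imsetP => [[/bigcupP[i _ /bigcupP[x xd /set1P ->]] _]|[[i x] rd ->]].
  by exists (i, x) => //; rewrite inE.
split.
  apply/bigcupP; exists i => //; apply/bigcupP; exists x; last exact: set11.
  by move: rd; rewrite inE.
(* The filter in [span_graph] asks for two distinct ends; they differ at coordinate [i]. *)
case/meetsP: (eps_meets rd (heps _ rd)) => y [-> xi _].
by rewrite cards2; case: (x =P y) => // xy; move: xi; rewrite xy; lia.
Qed.
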